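(* Let $V$ be a finite-dimensional real vector space and $P\subseteq V$ a polytope. Then in $\mathcal{P}(V)$ \[ *P = -\sum_{F\in\mathcal{F}(P)}(-1)^{\dim F}\cdot F. \]
   Context: A polytope in $V$ is the convex hull of a nonempty finite set; $\mathcal{P}(V)$ is the Grothendieck group of the monoid of polytopes in $V$ under Minkowski sum. $*P=\{-p: p\in P\}$. For $\phi\in\mathrm{Hom}(V,\mathbb{R})$, $F_\phi(P)=\{p\in P:\phi(p)=\max_{q\in P}\phi(q)\}$; a face of $P$ is a subset of the form $F_\phi(P)$ for some $\phi$ (including $\phi=0$, giving $P$ itself). $\mathcal{F}(P)$ is the set of faces of $P$, including $P$. *)

(* Defs.v *)
From HB Require Import structures.
From mathcomp Require Import all_boot all_order all_algebra.
From Stdlib Require Import ClassicalEpsilon.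
Set Implicit Arguments.
Unset Strict Implicit.
Unset Printing Implicit Defensive.
Import Order.TTheory GRing.Theory Num.Theory.
Local Open Scope ring_scope.

Definition pb (P : Prop) : bool :=
  if excluded_middle_informative P then true else false.

Section Polytopes.
Variables (R : realFieldType) (V : vectType R).

Definition pset := V -> Prop.
Definition seteq (A B : pset) : Prop := forall x, A x <-> B x.

Definition conv (s : seq V) : pset := fun x =>
  exists w : 'I_(size s) -> R,
    (forall i, 0 <= w i) /\ \sum_i w i = 1 /\ x = \sum_i w i *: s`_i.

Definition is_polytope (A : pset) : Prop :=
  exists s : seq V, s <> [::] /\ seteq A (conv s).

Definition msum (A B : pset) : pset := fun x =>
  exists a b, A a /\ B b /\ x = a + b.
Definition pzero : pset := fun x => x = 0.
Definition msum_seq (s : seq pset) : pset := foldr msum pzero s.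

Definition pneg (A : pset) : pset := fun x => A (- x).

Definition face_of (P : pset) (phi : V -> R) : pset := fun p =>
  P p /\ forall q, P q -> phi q <= phi p.

Definition is_face (P F : pset) : Prop :=
  exists phi : {linear V -> R^o}, seteq F (face_of P phi).

Definition affdim (A : pset) : nat :=
  \max_(k < (\dim (fullv : {vspace V})).+1 |
        pb (exists s : seq V, size s = k /\ free s /\
              forall i, (i < k)%N -> exists x y, A x /\ A y /\ s`_i = x - y)) k.

Definition face_enum (P : pset) (fs : seq pset) : Prop :=
  (forall F, is_face P F <-> exists i : 'I_(size fs), seteq F (nth pzero fs i)) /\
  (forall i j : 'I_(size fs), seteq (nth pzero fs i) (nth pzero fs j) -> i = j).

(* [A] = [B] in the Grothendieck group P(V) of the monoid of polytopes
   under Minkowski sum (A, B Minkowski sums of polytopes) *)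
Definition groth_eq (A B : pset) : Prop :=
  exists K : pset, is_polytope K /\ seteq (msum A K) (msum B K).

End Polytopes.

(* Main.v *)
(** Polytopes are determined by their support functions, by Farkas' lemma, and
    support functions are additive under Minkowski sum.  The theorem thus says
    that [\sum_F (-1)^{dim F} max_F f = min_P f] for every linear form [f].
    Grouping the faces by the value of [max_F f], this amounts to the vanishing
    of the Euler sums [\sum_F (-1)^{dim F}] over the faces (the empty one
    included) contained in a half-space that meets [P].

    For these we encode a face by the set of indices of the generating points
    that lie on it, so that faces are zero sets of nonnegative affine forms.
    Fix faces [J] and [K], a form [f] vanishing on [J], and consider the faces
    between [J] and [K] on which [f] is positive outside [J].  Adding to [f]
    increasing multiples of a form [h] that exposes [J], the points of [K] enter
    the positive half-space one level at a time.  The faces entering at a given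
    level are grouped by their intersection [J'] with the hyperplane, and each
    group is a sum of the same kind for the smaller interval [J', K], hence
    vanishes by induction.  Starting from the level where [f] exposes a proper
    face of [K], this yields that the sum over the whole interval vanishes. *)

Require Import Defs.
From HB Require Import structures.
From mathcomp Require Import all_boot ssrAC all_order all_algebra.
From mathcomp Require Import ring lra.
From Stdlib Require Import Classical ClassicalEpsilon.
Set Implicit Arguments.
Unset Strict Implicit.
Unset Printing Implicit Defensive.
Import Order.TTheory GRing.Theory Num.Theory.
Local Open Scope ring_scope.

(** * Euler sums over intervals of faces *)

Lemma pbP (P : Prop) : reflect P (pb P).
Proof. by rewrite /pb; case: excluded_middle_informative => H; constructor. Qed.

Lemma exists_uniform_eps (R : realFieldType) (T : finType) (P : T -> R -> Prop) :
  (forall i, exists2 e, 0 < e & forall d, 0 < d -> d <= e -> P i d) ->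
  exists2 e, 0 < e & forall i, P i e.
Proof.
move=> H; suff [e e0 He] : exists2 e, 0 < e &
    forall i, i \in enum T -> forall d, 0 < d -> d <= e -> P i d.
  by exists e => // i; apply: He => //; rewrite mem_enum.
elim: (enum T) => [|j s [e e0 He]]; first by exists 1.
have [e' e'0 He'] := H j; exists (Num.min e e'); first by rewrite lt_min e0.
move=> i; rewrite inE => /orP[/eqP->|is_] d d0; rewrite le_min => /andP[d1 d2].
  exact: He'.
exact: He.
Qed.

Lemma gt0_perturb (R : realFieldType) (T : finType) (f h : T -> R) :
  exists2 e, 0 < e & forall i, 0 < f i -> 0 < f i + e * h i.
Proof.
apply: (@exists_uniform_eps R T (fun i e => 0 < f i -> 0 < f i + e * h i)) => i.
have [fi|fi] := boolP (0 < f i); last by exists 1.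
have n0 : 0 <= `|h i| by [].
exists (f i / (1 + `|h i|)) => [|d d0]; first by rewrite divr_gt0 ?ltr_wpDr.
have p0 : 0 < 1 + `|h i| by rewrite ltr_wpDr.
rewrite ler_pdivlMr // => dle _.
have : - `|h i| <= h i by rewrite lerNl -normrN ler_norm.
nra.
Qed.

Lemma lt0_perturb (R : realFieldType) (T : finType) (f h : T -> R) :
  exists2 e, 0 < e & forall i, f i < 0 -> f i + e * h i < 0.
Proof.
have [e e0 He] := gt0_perturb (fun i => - f i) (fun i => - h i).
by exists e => // i fi; have := He i; rewrite oppr_gt0 mulrN -opprD oppr_gt0; apply.
Qed.

Section Euler.
Variables (R : realFieldType) (T : finType) (Phi : (T -> R) -> Prop).
Variable r : {set T} -> nat.
Hypothesis PhiD : forall f g c, Phi f -> Phi g -> Phi (fun i => f i + c * g i).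

Definition exposed (I : {set T}) : bool :=
  pb (exists f, Phi f /\ (forall i, 0 <= f i) /\ forall i, (i \in I) = (f i == 0)).

(* [K] covers [J] as soon as the forms vanishing on [J] restrict to a line on [K]. *)
Hypothesis rank_cover : forall (J K : {set T}) h k,
  J \subset K -> k \in K -> Phi h ->
  (forall i, i \in J -> h i = 0) -> 0 < h k ->
  (forall f, Phi f -> (forall i, i \in J -> f i = 0) -> f k = 0 ->
     forall i, i \in K -> f i = 0) ->
  r K = (r J).+1.

Definition sgn I : R := (-1) ^+ r I.

Definition Esum (J B : {set T}) : R :=
  \sum_(I | [&& exposed I, J \subset I & I \subset B]) sgn I.

Definition pos (K : {set T}) f : {set T} := [set i in K | 0 < f i :> R].
Definition nneg (K : {set T}) f : {set T} := [set i in K | 0 <= f i :> R].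


Lemma exposedP (I : {set T}) : reflect
  (exists f, Phi f /\ (forall i, i \in I -> f i = 0) /\
     forall i, i \notin I -> 0 < f i) (exposed I).
Proof.
apply: (iffP (pbP _)) => -[f [Pf [f0 If]]]; exists f; split=> //; split=> i.
- by rewrite If => /eqP.
- by rewrite If lt_def f0 andbT.
- by have [/f0->//|/If/ltW] := boolP (i \in I).
- by have [/f0->|/If/gt_eqF->//] := boolP (i \in I); rewrite eqxx.
Qed.

(** A face of a face is a face: if [h] exposes [I], then [h + e * f] with small [e > 0] stays
    positive off [I] and is a multiple of [f] on it. *)
Lemma exposed_sub_face (I : {set T}) f : exposed I -> Phi f ->
  (forall i, i \in I -> 0 <= f i) -> exposed [set i in I | f i == 0].
Proof.
move=> /exposedP[h [Ph [h0 hp]]] Pf f0; have [e e0 He] := gt0_perturb h f.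
apply/exposedP; exists (fun i => h i + e * f i); split; first exact: PhiD.
split=> i; rewrite inE.
  by case/andP=> iI /eqP->; rewrite h0 // mulr0 addr0.
have [iI /=|/hp/He//] := boolP (i \in I).
by move=> fi; rewrite h0 // add0r mulr_gt0 // lt_def fi f0.
Qed.

(** Group the faces [I] inside [nneg K f] by the subset [J'] of [I] where [f] is zero. The group of
    [J'] is the interval sum [Esum J' (J' :|: pos K f)], which the last hypothesis kills except for
    [J' = J]. *)
Lemma Esum_nneg (J K : {set T}) f : exposed J -> exposed K -> J \subset K ->
  Phi f -> (forall i, i \in J -> f i = 0) ->
  (forall J' : {set T}, exposed J' -> J \proper J' -> J' \subset K ->
     (forall i, i \in J' -> f i = 0) -> Esum J' (J' :|: pos K f) = 0) ->
  Esum J (nneg K f) = Esum J (J :|: pos K f).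
Proof.
move=> eJ eK sJK Pf fJ IH; rewrite /Esum.
pose z (I : {set T}) := [set i in I | f i == 0].
pose Q (J' : {set T}) := [&& exposed J', J \subset J', J' \subset K &
                       [forall i in J', f i == 0]].
rewrite (partition_big z Q) /=; last first.
  move=> I /and3P[eI sJI sI]; apply/and4P; split.
  - apply: exposed_sub_face => // i /(subsetP sI).
    by rewrite inE => /andP[].
  - by apply/subsetP=> i iJ; rewrite inE (subsetP sJI) //= fJ.
  - apply/subsetP=> i; rewrite inE => /andP[/(subsetP sI)].
    by rewrite inE => /andP[].
  - by apply/forall_inP=> i; rewrite inE => /andP[].
have inner J' : Q J' ->
   \sum_(I | [&& exposed I, J \subset I & I \subset nneg K f] && (z I == J')) sgn I
   = Esum J' (J' :|: pos K f).
  case/and4P=> eJ' sJ sK /forall_inP f0; apply: eq_bigl => I.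
  have [eI|//] := boolP (exposed I); rewrite /=.
  apply/andP/andP=> [[/andP[s1 s2] /eqP <-]|[s1 s2]].
    split; first by apply/subsetP=> i; rewrite inE => /andP[].
    apply/subsetP=> i iI; have := subsetP s2 _ iI.
    by rewrite !inE iI le_eqVlt eq_sym => /andP[->].
  split.
    rewrite (subset_trans sJ s1) /=; apply/subsetP=> i /(subsetP s2).
    rewrite !inE => /orP[iJ|/andP[-> /ltW]//].
    by rewrite (subsetP sK) //= (eqP (f0 _ iJ)).
  apply/eqP/setP=> i; rewrite inE; apply/andP/idP=> [[iI fi]|iJ].
    have := subsetP s2 _ iI; rewrite !inE (eqP fi) ltxx andbF orbF //.
  by rewrite (subsetP s1) // f0.
rewrite (eq_bigr _ inner) (bigD1 J) /=; last first.
  by apply/and4P; split=> //; apply/forall_inP => i /fJ->.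
rewrite big1 ?addr0 // => J' /andP[/and4P[eJ' s1 s2 /forall_inP f0] nJ].
apply: IH => // [|i /f0/eqP//].
by rewrite properEneq eq_sym nJ.
Qed.

(** The premise allows the zeros of a form to be added for free. With [h] exposing [J], raise [t] in
    [f + t * h] until a new point of [K] reaches level zero; add it, push slightly further, and
    repeat until [K] is exhausted. *)
Lemma Esum_sweep (J K : {set T}) : exposed J -> exposed K -> J \subset K ->
  (forall f, Phi f -> (forall i, i \in J -> f i = 0) -> pos K f != set0 ->
    Esum J (nneg K f) = Esum J (J :|: pos K f)) ->
  forall f, Phi f -> (forall i, i \in J -> f i = 0) -> pos K f != set0 ->
    Esum J (J :|: pos K f) = Esum J K.
Proof.
move=> eJ eK sJK step f.
have [h [Ph [h0 hp]]] := exposedP _ eJ.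
have [m] := ubnP #|K :\: (J :|: pos K f)|.
elim: m f => // m IH f; rewrite ltnS => lem Pf fJ fpos.
have [D0|[i0 i0D]] := set_0Vmem (K :\: (J :|: pos K f)).
  congr Esum; apply/eqP; rewrite eqEsubset subUset sJK.
  rewrite -[K \subset _]setD_eq0 D0 eqxx andbT /=.
  by apply/subsetP=> i; rewrite inE => /andP[].
(* [- f i / h i] is the time at which point [i] reaches level zero; [j] arrives first, so nothing
   new is positive at that time. *)
case: (arg_minP (fun i => - f i / h i) i0D) => j jD' jmin'.
have jD : j \in K :\: (J :|: pos K f) := jD'.
have jmin i : i \in K :\: (J :|: pos K f) -> - f j / h j <= - f i / h i := jmin' i.
set t := - f j / h j.
have [jJ [jK fj]] : j \notin J /\ j \in K /\ f j <= 0.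
  move: jD; rewrite !inE negb_or negb_and -leNgt.
  by case/andP=> /andP[-> /orP[/negP|->]] // H jK.
have hj := hp _ jJ.
have t0 : 0 <= t by rewrite divr_ge0 ?oppr_ge0 // ltW.
have tle i : i \in K -> i \notin J -> f i <= 0 -> f i + t * h i <= 0.
  move=> iK iJ fi; have := jmin i; rewrite !inE (negPf iJ) iK ltNge fi /=.
  move=> /(_ isT); rewrite -/t ler_pdivlMr ?hp // => H; lra.
pose f1 i := f i + t * h i.
have Pf1 : Phi f1 by apply: PhiD.
have f1J i : i \in J -> f1 i = 0.
  by move=> iJ; rewrite /f1 fJ // h0 // mulr0 addr0.
have hge i : 0 <= h i by have [/h0->//|/hp/ltW] := boolP (i \in J).
have posE : pos K f1 = pos K f.
  apply/setP=> i; rewrite !inE; have [iK|//] := boolP (i \in K).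
  have [iJ|iJ] := boolP (i \in J); first by rewrite f1J // fJ.
  have [fi|fi] := leP (f i) 0; first by rewrite ltNge /f1 tle.
  by rewrite /f1 ltr_wpDr // mulr_ge0.
rewrite -posE -step ?posE //.
(* A slight further push makes the zeros of [f1] outside [J] positive and keeps the negative values
   negative. *)
have [e e0 He] := lt0_perturb f1 h.
pose f2 i := f1 i + e * h i.
have Pf2 : Phi f2 by apply: PhiD.
have f2J i : i \in J -> f2 i = 0.
  by move=> iJ; rewrite /f2 f1J // h0 // mulr0 addr0.
have nnE : nneg K f1 = J :|: pos K f2.
  apply/setP=> i; rewrite !inE.
  have [iJ|iJ] /= := boolP (i \in J); first by rewrite (subsetP sJK) //= f1J ?lexx.
  case: (i \in K) => //=; have [fi|/He fi] := leP 0 (f1 i).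
    by rewrite /f2 ltr_wpDl // mulr_gt0 // hp.
  by rewrite ltNge ltW.
have pos_sub : pos K f \subset pos K f2.
  rewrite -posE; apply/subsetP=> i; rewrite !inE => /andP[-> fi] /=.
  by rewrite ltr_wpDr // mulr_ge0 // ltW.
rewrite nnE IH //.
  apply: leq_trans lem; apply: proper_card; apply/properP; split.
    by apply: setDS; apply: setUS.
  exists j => //; rewrite inE -nnE inE jK /f1 /t divfK ?gt_eqF //.
  by rewrite addrN lexx.
by apply: contraNneq fpos => p0; rewrite p0 subset0 in pos_sub.
Qed.

(** Induction on the size of [K :\: J]. The second claim for smaller intervals ending at [K] feeds
    the sweep, which reduces everything to [Esum J K = 0]. Either there is a face [M] strictly
    between, cut out by a form, and [Esum J K = Esum J M = 0] by induction, or only [J] and [K] lie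
    in the interval and their signs cancel. *)
Lemma Esum_proper (J K : {set T}) : exposed J -> exposed K -> J \proper K ->
  Esum J K = 0 /\
  forall f, Phi f -> (forall i, i \in J -> f i = 0) -> pos K f != set0 ->
    Esum J (J :|: pos K f) = 0.
Proof.
have [m] := ubnP #|K :\: J|.
elim: m J K => // m IH J K; rewrite ltnS => lem eJ eK pJK.
have sJK := proper_sub pJK.
have ltm (J' M : {set T}) : J \subset J' -> M \subset K -> J' \subset M ->
    (J \proper J') || (M \proper K) -> (#|M :\: J'| < m)%N.
  move=> s1 s2 s3 H; apply: leq_trans lem; apply: proper_card.
  apply/properP; split; first exact: setDSS.
  case/orP: H => /properP[_ [i iA iB]]; exists i; rewrite !inE ?iA ?(negPf iB) ?andbF //=.
    by rewrite (subsetP s2) ?(subsetP s3).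
  by rewrite andbT; apply: contra iB => /(subsetP s1)/(subsetP s3).
have sweep : forall f, Phi f -> (forall i, i \in J -> f i = 0) ->
    pos K f != set0 -> Esum J (J :|: pos K f) = Esum J K.
  apply: Esum_sweep => // f Pf fJ fp; apply: Esum_nneg => // J1 eJ1 pJ1 sJ1K fJ1.
  case: (IH J1 K) => //; first by rewrite ltm // ?proper_sub // pJ1.
    (* [J1 = K] is impossible, as [f] vanishes on [J1] but is positive somewhere on [K]. *)
    rewrite properEneq sJ1K andbT; apply: contraNneq fp => eq.
    apply/eqP/setP=> i; rewrite !inE; have [iK|//] := boolP (i \in K).
    by rewrite fJ1 ?eq ?ltxx.
  by move=> _; apply.
suff E0 : Esum J K = 0 by split=> // f Pf fJ fp; rewrite sweep.
have [h [Ph [h0 hp]]] := exposedP _ eJ.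
have [_ [k kK kJ]] := properP pJK.
have hk := hp _ kJ.
case: (classic (exists f, [/\ Phi f, forall i, i \in J -> f i = 0 &
   exists2 i, i \in K & f i * h k != f k * h i])) => [[f [Pf fJ [i1 i1K ne]]]|prop].
- have kD : k \in K :\: J by rewrite inE kJ.
  case: (arg_maxP (fun i => f i / h i) kD) => j jD jmax'.
  have /setDP[jK jJ] : j \in K :\: J := jD.
  have jmax i : i \in K :\: J -> f i / h i <= f j / h j := jmax' i.
  (* With [c] the largest ratio [f / h] on [K] off [J], the form [f - c * h] is nonpositive on [K]
     and zero at [j]. Its zeros in [K] form a face [M] larger than [J], and smaller than [K] because
     [f] is not proportional to [h] there. *)
  set c := f j / h j.
  pose g i := f i + (- c) * h i.
  have Pg : Phi g by apply: PhiD.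
  have gJ i : i \in J -> g i = 0 by move=> iJ; rewrite /g fJ // h0 // mulr0 addr0.
  have gle i : i \in K -> g i <= 0.
    move=> iK; have [/gJ->//|iJ] := boolP (i \in J).
    have := jmax i; rewrite inE iJ iK => /(_ isT).
    by rewrite -/c /g ler_pdivrMr ?hp // mulNr subr_le0.
  have gj : g j = 0 by rewrite /g mulNr divfK ?subrr // gt_eqF ?hp.
  pose M := nneg K g.
  have ME : M = [set i in K | (- g i) == 0].
    apply/setP=> i; rewrite !inE; have [iK|//] := boolP (i \in K).
    by rewrite oppr_eq0 eq_le gle.
  (* This is [- g], in the shape that [PhiD] provides. *)
  have PNg : Phi (fun i => g i + (-2) * g i) by apply: PhiD.
  have eM : exposed M.
    rewrite (_ : M = [set i in K | g i + (-2) * g i == 0]); last first.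
      rewrite ME; apply/setP=> i; rewrite !inE; congr (_ && (_ == 0)); ring.
    by apply: exposed_sub_face => // i /gle gi; lra.
  have sMK : M \subset K by apply/subsetP=> i; rewrite inE => /andP[].
  have pJM : J \proper M.
    apply/properP; split; last by exists j => //; rewrite inE jK gj lexx.
    by apply/subsetP=> i iJ; rewrite inE (subsetP sJK) //= gJ.
  have pMK : M \proper K.
    rewrite properEneq sMK andbT; apply: contraNneq ne => MK.
    have gK i : i \in K -> f i = c * h i.
      rewrite -{1}MK ME inE oppr_eq0 => /andP[_ /eqP]; rewrite /g; lra.
    by rewrite (gK _ i1K) (gK _ kK) mulrAC.
  (* Tilting [g] by a small multiple of [h] presents [M] as [J :|: pos K _], to which the sweep
     applies. *)
  have [e e0 He] := lt0_perturb g h.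
  have Eg : M = J :|: pos K (fun i => g i + e * h i).
    apply/setP=> i; rewrite !inE.
    have [iJ|iJ] /= := boolP (i \in J); first by rewrite (subsetP sJK) //= gJ ?lexx.
    case: (i \in K) => //=; have [gi|/He gi] := leP 0 (g i).
      by rewrite ltr_wpDl // mulr_gt0 // hp.
    by rewrite ltNge ltW.
  rewrite -(sweep (fun i => g i + e * h i)).
  + rewrite -Eg; case: (IH J M) => //.
    by apply: ltm => //; [exact: proper_sub | rewrite pMK orbT].
  + exact: PhiD.
  + by move=> i iJ; rewrite gJ // h0 // mulr0 addr0.
  + by apply/set0Pn; exists j; rewrite inE jK gj add0r mulr_gt0 ?hp.
have prop' f : Phi f -> (forall i, i \in J -> f i = 0) ->
    forall i, i \in K -> f i * h k = f k * h i.
  move=> Pf fJ i iK; apply/eqP/negPn/negP=> ne.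
  by apply: prop; exists f; split=> //; exists i.
have neJK : K != J by apply: contraNneq kJ => <-.
have rK : r K = (r J).+1.
  apply: (rank_cover sJK kK Ph h0 hk) => f Pf fJ fk i iK.
  have /eqP := prop' f Pf fJ i iK; rewrite fk mul0r mulf_eq0 (gt_eqF hk) orbF.
  by move/eqP.
rewrite /Esum (bigD1 J) ?eJ ?subxx ?sJK //= (bigD1 K) ?eK ?sJK ?subxx ?neJK //=.
rewrite big1 ?addr0 /sgn ?rK ?exprS ?mulN1r ?subrr // => I.
case/andP=> /andP[/and3P[eI sJI sIK] nIJ] nIK.
(* The form exposing [I] is proportional to [h] on [K]: if it vanishes at [k], then [I = K], and
   otherwise [I = J]. *)
have [f [Pf [f0 fp]]] := exposedP _ eI.
have fJ i : i \in J -> f i = 0 by move=> iJ; rewrite f0 // (subsetP sJI).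
have [kI|kI] := boolP (k \in I).
  case/negP: nIK; rewrite eqEsubset sIK; apply/subsetP=> i iK.
  apply/negPn/negP=> /fp fi; have := prop' f Pf fJ i iK.
  by rewrite (f0 k) // mul0r => /eqP; rewrite mulf_eq0 (gt_eqF hk) (gt_eqF fi).
case/negP: nIJ; rewrite eqEsubset sJI andbT; apply/subsetP=> i iI.
apply/negPn/negP=> iJ; have := prop' f Pf fJ i (subsetP sIK _ iI).
rewrite (f0 i) // mul0r => /esym/eqP; rewrite mulf_eq0 (gt_eqF (fp _ kI)).
by rewrite (gt_eqF (hp _ iJ)).
Qed.

(** * Half-spaces and the alternating sum of maxima *)

Hypothesis Phi1 : Phi (fun=> 1).
Hypothesis Phi0 : Phi (fun=> 0).
Hypothesis r0 : r set0 = 0%N.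

Lemma exposed0 : exposed set0.
Proof. by apply/exposedP; exists (fun=> 1); split=> //; split=> i; rewrite ?inE. Qed.

Lemma exposedT : exposed setT.
Proof. by apply/exposedP; exists (fun=> 0); split=> //; split=> i; rewrite ?inE. Qed.

(** If some value is positive, [Esum_proper] applies between the empty face and the full one;
    otherwise only the empty face is left, with sign [1]. *)
Lemma Esum_pos f : Phi f -> Esum set0 [set i | 0 < f i] = (~~ [exists i, 0 < f i])%:R.
Proof.
move=> Pf; have [[i fi]|no] := existsP.
  have [|_ ] := Esum_proper exposed0 exposedT; first by apply/properP; split;
    [exact: sub0set | exists i; rewrite inE].
  move=> /(_ f Pf); rewrite set0U.
  rewrite (_ : pos setT f = [set i | 0 < f i]); last by apply/setP=> j; rewrite !inE.
  apply; first by move=> j; rewrite inE.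
  by apply/set0Pn; exists i; rewrite inE.
rewrite (_ : [set i | _] = set0) /Esum.
  rewrite (big_pred1 set0) ?/sgn ?r0 // => I.
  by rewrite sub0set /= subset0; case: eqP => [->|]; rewrite ?exposed0 ?andbF.
by apply/setP=> i; rewrite !inE; apply/negP=> fi; apply: no; exists i.
Qed.

(** On finitely many points, a closed half-space is the open half-space of [f + e] for small
    [e > 0]. *)
Lemma Esum_ge0 f i : Phi f -> 0 <= f i -> Esum set0 [set i | 0 <= f i] = 0.
Proof.
move=> Pf fi; have [e e0 He] := lt0_perturb f (fun=> 1).
rewrite (_ : [set _ | _] = [set i | 0 < f i + e * 1]).
  rewrite Esum_pos; last exact: PhiD.
  have -> // : [exists i, 0 < f i + e * 1].
  by apply/existsP; exists i; rewrite mulr1 ltr_wpDl.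
apply/setP=> j; rewrite !inE; have [fj|/He fj] := leP 0 (f j).
  by rewrite mulr1 ltr_wpDl.
by rewrite ltNge ltW.
Qed.

(** Here [g I] is the maximum of [a] on [I] and [m] the minimum of [a]. The faces with [g I = x] are
    those inside [a <= x] but not inside [a < x], so for each value [x] of [a] their signs sum to
    [0 - (x == m)]; weighting by [x] leaves [- m]. *)
Lemma sum_sgn_max a (g : {set T} -> R) (m : R) (i0 : T) :
  (forall c, Phi (fun i => c - a i)) ->
  (forall (I : {set T}) i, i \in I -> a i <= g I) ->
  (forall I : {set T}, I != set0 -> exists2 i, i \in I & a i = g I) ->
  a i0 = m -> (forall i, m <= a i) ->
  \sum_(I | exposed I && (I != set0)) sgn I * g I = - m.
Proof.
move=> Pa gle gmax ai0 mle.
have level i : \sum_(I | [&& exposed I, I != set0 & g I == a i]) sgn I = - (a i == m)%:R.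
  have := Esum_ge0 (i := i) (Pa (a i)); rewrite subrr => /(_ (lexx _)).
  have := Esum_pos (Pa (a i)).
  rewrite (_ : [exists j, _] = (a i != m)); last first.
    apply/existsP/idP => [[j]|ne].
      by rewrite subr_gt0 => aj; rewrite gt_eqF // (le_lt_trans (mle j)).
    by exists i0; rewrite ai0 subr_gt0 lt_def ne mle.
  rewrite negbK => E1 E2.
  suff E3 : Esum set0 [set j | 0 <= a i - a j] =
      \sum_(I | [&& exposed I, I != set0 & g I == a i]) sgn I +
      Esum set0 [set j | 0 < a i - a j].
    by apply/eqP; rewrite -addr_eq0 -E1 -E3 E2.
  rewrite /Esum [LHS](bigID (fun I : {set T} => (I != set0) && (g I == a i))) /=.
  congr (_ + _); apply: eq_bigl => I; have [eI|//] := boolP (exposed I) => /=.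
    rewrite sub0set /= andbC; have [->|nI] := eqVneq I set0; rewrite ?andbF //=.
    have [gI|//] := eqVneq; apply/subsetP=> j /gle; rewrite gI inE subr_ge0 //.
  rewrite !sub0set /=; have [->|nI] := eqVneq I set0; first by rewrite !sub0set.
  have [j jI aj] := gmax I nI; apply/andP/subsetP => [[/subsetP s1 s2] k kI|s1].
    rewrite inE subr_gt0 (le_lt_trans (gle _ _ kI)) // lt_def eq_sym s2 -aj.
    by have := s1 _ jI; rewrite inE subr_ge0.
  have := s1 _ jI; rewrite inE subr_gt0 aj => lt; rewrite lt_eqF // ; split=> //.
  by apply/subsetP=> k /s1; rewrite !inE => /ltW.
pose u := undup (codom a).
have uP (I : {set T}) : I != set0 -> g I \in u.
  by move=> /gmax[i _ <-]; rewrite mem_undup codom_f.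
transitivity (\sum_(x <- u) x * \sum_(I | [&& exposed I, I != set0 & g I == x]) sgn I).
  transitivity (\sum_(I | exposed I && (I != set0)) \sum_(x <- u | g I == x) x * sgn I).
    apply: eq_bigr => I /andP[_ /uP gu].
    rewrite (eq_bigl (pred1 (g I))) => [|x]; last exact: eq_sym.
    by rewrite -big_filter filter_pred1_uniq ?undup_uniq // big_seq1 mulrC.
  rewrite (exchange_big_dep predT) //=; apply: eq_bigr => x _.
  by rewrite big_distrr /=; apply: eq_bigl => I; rewrite andbA.
transitivity (\sum_(x <- u | x == m) (- x)).
  rewrite [RHS]big_mkcond; apply: eq_big_seq => x /=.
  rewrite mem_undup => /codomP[i ->]; rewrite level.
  by case: eqP; rewrite ?oppr0 ?mulr0 // mulrN mulr1.
by rewrite -big_filter filter_pred1_uniq ?undup_uniq ?big_seq1 // mem_undup -ai0 codom_f.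
Qed.
End Euler.

(** * Linear forms and Farkas' lemma *)

Definition islin (R : realFieldType) (V : vectType R) (f : V -> R) :=
  forall a x y, f (a *: x + y) = a * f x + f y.

Section LinearForms.
Variables (R : realFieldType) (V : vectType R).
Implicit Types f : V -> R.

Lemma islin_linear (phi : {linear V -> R^o}) : islin (phi : V -> R).
Proof. by move=> a x y; rewrite linearP. Qed.

Lemma islin_exists f : islin f -> exists phi : {linear V -> R^o}, (phi : V -> R) =1 f.
Proof.
move=> fl; have lf : linear (f : V -> R^o) by move=> a x y; rewrite fl.
pose m := GRing.isLinear.Build R V R^o *:%R (f : V -> R^o) lf.
pose phi : {linear V -> R^o} := HB.pack (f : V -> R^o) m.
by exists phi.
Qed.

Lemma islin_comb f g c : islin f -> islin g -> islin (fun x => f x + c * g x).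
Proof. by move=> fl gl a x y; rewrite fl gl; ring. Qed.

Lemma islinN f : islin f -> islin (fun x => - f x).
Proof. by move=> fl a x y; rewrite fl; ring. Qed.

Lemma lin0 f : islin f -> f 0 = 0.
Proof. by move=> fl; have := fl 1 0 0; rewrite scale1r addr0; lra. Qed.

Lemma linD f x y : islin f -> f (x + y) = f x + f y.
Proof. by move=> fl; rewrite -[x]scale1r fl mul1r scale1r. Qed.

Lemma linZ f a x : islin f -> f (a *: x) = a * f x.
Proof. by move=> fl; rewrite -[a *: x]addr0 fl lin0 // addr0. Qed.

Lemma linN f x : islin f -> f (- x) = - f x.
Proof. by move=> fl; rewrite -scaleN1r linZ // mulN1r. Qed.

Lemma linB f x y : islin f -> f (x - y) = f x - f y.
Proof. by move=> fl; rewrite linD // linN. Qed.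

Lemma lin_sum f (I : finType) (w : I -> R) (x : I -> V) : islin f ->
  f (\sum_i w i *: x i) = \sum_i w i * f (x i).
Proof.
move=> fl; rewrite (big_morph f (fun x y => linD x y fl) (lin0 fl)).
by apply: eq_bigr => i _; rewrite linZ.
Qed.

(** The vector [v - projv U v] is nonzero, so one of its coordinates is; that coordinate of
    [x - projv U x] is the form. *)
Lemma exists_lin_ne0 (U : {vspace V}) v : v \notin U ->
  exists f, [/\ islin f, forall u, u \in U -> f u = 0 & f v != 0].
Proof.
move=> vU; pose w := v - projv U v; pose b := vbasis {: V}%VS.
have [i wi] : exists i, coord b i w != 0.
  apply: NNPP => no; case/negP: vU.
  suff /eqP : w = 0 by rewrite subr_eq0 => /eqP->; exact: memv_proj.
  rewrite (coord_vbasis (memvf w)) big1 // => i _.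
  by have [->|wi] := eqVneq (coord b i w) 0; [rewrite scale0r | case: no; exists i].
exists (fun x => coord b i (x - projv U x)); split=> // [a x y|u uU].
  by rewrite -linearP /=; congr (coord _ _ _); rewrite linearP scalerBr opprD addrACA.
by rewrite projv_id // subrr linear0.
Qed.

Fixpoint cone (s : seq V) (v : V) : Prop :=
  if s is a :: s' then exists2 c, 0 <= c & cone s' (v - c *: a) else v = 0.

(** Undoing the shear moves the multiples of [a] to the other side; their total coefficient is
    nonpositive since every [f g] is. *)
Lemma cone_shear a f (s : seq V) v : (forall g : V, g \in s -> f g <= 0) ->
  cone [seq g - f g *: a | g <- s] v -> exists2 t, t <= 0 & cone s (v + t *: a).
Proof.
elim: s v => [v _ ->|g s IH v fs [c c0]]; first by exists 0; rewrite // scale0r addr0.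
case/IH=> [g' gs|t t0 ct]; first by apply: fs; rewrite inE gs orbT.
have fg : f g <= 0 by apply: fs; rewrite inE eqxx.
exists (t + c * f g); first by nra.
exists c => //; move: ct.
by rewrite scalerBr scalerDl scalerA opprB !addrA [X in cone s X -> _](ACl (1*4*2*3)).
Qed.

(* Bartl's algebraic proof: shear along [a] to get rid of one generator. *)
Lemma farkas (s : seq V) v : cone s v \/
  exists f, [/\ islin f, forall g : V, g \in s -> f g <= 0 & 0 < f v].
Proof.
have [n] := ubnP (size s); elim: n s v => // n IH [v _|a s v].
  have [->|v0] := eqVneq v 0; [by left | right].
  have [|f [fl _ fv]] := @exists_lin_ne0 0%VS v; first by rewrite memv0.
  have [fp|fn|fe] := ltgtP 0 (f v); first by exists f.
    by exists (fun x => - f x); split=> //; [exact: islinN | rewrite oppr_gt0].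
  by rewrite -fe eqxx in fv.
rewrite /= !ltnS => sn; case: (IH s v sn) => [cv|[f0 [fl fs fv]]].
  by left; exists 0; rewrite // scale0r subr0.
have [fa|fa] := leP (f0 a) 0.
  by right; exists f0; split=> // g; rewrite inE => /orP[/eqP->|/fs].
(* Normalised so that [x0 a = 1]; then [g - x0 g *: a] is the projection of [g] along [a] onto the
   kernel of [x0]. *)
pose x0 x := f0 x / f0 a.
have x0s (g : V) : g \in s -> x0 g <= 0.
  by move=> /fs fg; rewrite /x0 ler_pdivrMr // mul0r.
have x0v : 0 < x0 v by rewrite divr_gt0.
have x0l : islin x0 by move=> c x y; rewrite /x0 fl; ring.
have x0a : x0 a = 1 by rewrite /x0 divff // gt_eqF.
case: (IH [seq g - x0 g *: a | g <- s] (v - x0 v *: a)); first by rewrite size_map.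
  case/(cone_shear x0s) => t t0 ct; left; exists (x0 v - t); first lra.
  by rewrite scalerBl opprB addrA addrAC.
(* This is [f] composed with that projection: it vanishes at [a]. *)
case=> f [gl gs gv]; right; exists (fun x => f x + (- f a) * x0 x); split.
- exact: islin_comb.
- move=> g; rewrite inE => /orP[/eqP->|gin]; first by rewrite x0a; lra.
  have := gs _ (map_f _ gin); rewrite linB // linZ //; lra.
- by move: gv; rewrite linB // linZ //; lra.
Qed.
End LinearForms.

(** * Convex hulls and support functions *)

Section Convexity.
Variables (R : realFieldType) (V : vectType R).
Implicit Types (A B : pset V) (s : seq V).

Definition convex A := forall x y t, 0 <= t -> t <= 1 -> A x -> A y ->
  A (t *: x + (1 - t) *: y).

Lemma conv_convex s : convex (conv s).
Proof.
move=> x y t t0 t1 [w [w0 [w1 ->]]] [w' [w'0 [w'1 ->]]].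
exists (fun i => t * w i + (1 - t) * w' i); split=> [i|].
  by rewrite addr_ge0 // mulr_ge0 // subr_ge0.
split; first by rewrite big_split /= -!mulr_sumr w1 w'1; ring.
rewrite !scaler_sumr -big_split /=; apply: eq_bigr => i _.
by rewrite [RHS]scalerDl !scalerA.
Qed.

Lemma conv_nth s (i : 'I_(size s)) : conv s s`_i.
Proof.
exists (fun j => (j == i)%:R); split=> [j|]; first by rewrite ler0n.
split; first by rewrite (bigD1 i) //= eqxx big1 ?addr0 // => j /negPf->.
rewrite (bigD1 i) //= eqxx scale1r big1 ?addr0 // => j /negPf->.
by rewrite scale0r.
Qed.

Lemma conv_mem s x : x \in s -> conv s x.
Proof.
move=> xs; have xi : (index x s < size s)%N by rewrite index_mem.
by have := conv_nth (Ordinal xi); rewrite /= nth_index.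
Qed.

(** Split off the first weight [t] and rescale the others by [1 / (1 - t)]. Points of weight zero
    may lie outside [A], which [face_of_hull] relies on. *)
Lemma convex_sum A n (w : 'I_n -> R) (x : 'I_n -> V) : convex A ->
  (forall i, 0 <= w i) -> \sum_i w i = 1 -> (forall i, w i != 0 -> A (x i)) ->
  A (\sum_i w i *: x i).
Proof.
move=> cA; elim: n w x => [|n IH] w x w0 w1 Ax.
  by move/eqP: w1; rewrite big_ord0 eq_sym oner_eq0.
move: w1; rewrite !big_ord_recl /=; set t := w ord0 => w1.
have rest0 : 0 <= \sum_(i < n) w (lift ord0 i) by rewrite sumr_ge0.
have [t1|t1] := leP 1 t.
  have s0 : \sum_(i < n) w (lift ord0 i) = 0 by lra.
  rewrite big1 => [|i _].
    have tE : t = 1 by lra.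
    by rewrite addr0 tE scale1r; apply: Ax; rewrite -/t tE oner_eq0.
  move/eqP: s0; rewrite psumr_eq0 // => /allP/(_ i).
  by rewrite mem_index_enum => /(_ isT)/eqP->; rewrite scale0r.
have u0 : 0 < 1 - t by lra.
pose y := \sum_(i < n) (w (lift ord0 i) / (1 - t)) *: x (lift ord0 i).
have -> : \sum_(i < n) w (lift ord0 i) *: x (lift ord0 i) = (1 - t) *: y.
  rewrite scaler_sumr; apply: eq_bigr => i _.
  by rewrite scalerA mulrC divfK // gt_eqF.
have Ay : A y.
  apply: IH => [i||i]; first by rewrite divr_ge0 // ltW.
    rewrite -mulr_suml (_ : \sum_(i < n) _ = 1 - t); last by lra.
    by rewrite divff // gt_eqF.
  by rewrite mulf_eq0 negb_or => /andP[wi _]; apply: Ax.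
have [->|tn] := eqVneq t 0; first by rewrite scale0r add0r subr0 scale1r.
by apply: (cA _ _ _ (w0 _) (ltW t1)) Ay; apply: Ax.
Qed.

Lemma conv_min A s : convex A -> (forall x, x \in s -> A x) ->
  forall x, conv s x -> A x.
Proof.
move=> cA As x [w [w0 [w1 ->]]]; apply: convex_sum => // i _.
by apply: As; rewrite mem_nth.
Qed.

(** With the points lifted to height [1], the height of a cone element is its total weight, so
    height [1] means a convex combination. *)
Lemma cone_weights s y c :
  cone [seq ((x, 1) : V * R^o) | x <- s] (y, c) ->
  exists w : 'I_(size s) -> R,
    (forall i, 0 <= w i) /\ \sum_i w i = c /\ y = \sum_i w i *: s`_i.
Proof.
elim: s y c => [y c [-> ->]|a s IH y c /= [t t0]].
  by exists (fun=> 0); split=> //; rewrite !big_ord0.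
have -> : (y, c) - t *: ((a, 1) : V * R^o) = (y - t *: a, c - t).
  by congr (_, _); rewrite /= -[t in RHS]mulr1.
case/IH=> w [w0 [w1 wy]].
exists (fun i => if unlift ord0 i is Some j then w j else t); split=> [i|].
  by case: unlift.
rewrite !big_ord_recl /= unlift_none.
have E j : unlift ord0 (lift ord0 j : 'I_(size s).+1) = Some j by rewrite liftK.
split.
  rewrite (eq_bigr w) ?w1 => [|i _]; last by rewrite E.
  by rewrite addrC subrK.
rewrite (eq_bigr (fun i => w i *: s`_i)) => [|i _]; last by rewrite E.
by rewrite -wy addrC subrK.
Qed.

(** Farkas' lemma for the lifted points separates [(x, 1)] from their cone; the last coordinate
    contributes equally at [x] and at the points of [s], hence drops out. *)
Lemma conv_sep s x : ~ conv s x ->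
  exists f, islin f /\ forall y, conv s y -> f y < f x.
Proof.
move=> nx; have [/cone_weights//|[f [fl fs fx]]] :=
  farkas [seq ((z, 1) : V * R^o) | z <- s] (x, 1).
pose g z := f (z, 0).
have gl : islin g.
  move=> a y z; rewrite /g -fl; congr (f (_, _)).
  by rewrite /= scaler0 addr0.
have gE z : f (z, 1) = g z + f (0, 1).
  by rewrite /g -linD //; congr (f (_, _)); rewrite /= ?addr0 ?add0r.
exists g; split=> // y.
apply: (@conv_min (fun y => g y < g x)) => [y1 y2 t t0 t1 h1 h2|z zs].
  rewrite gl linZ //; have [->|tn] := eqVneq t 0; first by rewrite mul0r subr0; lra.
  have p1 : 0 < t * (g x - g y1) by rewrite mulr_gt0 ?subr_gt0 // lt_def tn.
  have p2 : 0 <= (1 - t) * (g x - g y2) by rewrite mulr_ge0 ?subr_ge0 // ltW.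
  lra.
have : f (z, 1) <= 0 by apply: fs; apply: (map_f (fun z => (z, 1))).
by move: fx; rewrite (gE x) (gE z); lra.
Qed.

Lemma polytope_seteq A B : seteq A B -> is_polytope B -> is_polytope A.
Proof. by move=> AB [s [s0 Bs]]; exists s; split=> // x; rewrite AB Bs. Qed.

Lemma msum_seteq A A' B B' : seteq A A' -> seteq B B' -> seteq (msum A B) (msum A' B').
Proof.
move=> EA EB x; split=> -[a [b [Aa [Bb ->]]]]; exists a, b.
  by rewrite -EA -EB.
by rewrite EA EB.
Qed.

Lemma polytope_msum A B : is_polytope A -> is_polytope B -> is_polytope (msum A B).
Proof.
move=> [s [s0 As]] [t [t0 Bt]].
pose st := [seq a + b | a <- s, b <- t].
exists st; split.
  case: s t @st s0 t0 {As Bt} => [|a s] [|b t] //=.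
move=> x; rewrite (msum_seteq As Bt x); split.
  case=> a [b [sa [tb ->]]].
  apply: (@conv_min (fun b => conv st (a + b)) t) tb => {b} [y z u u0 u1 h1 h2|b bt].
    rewrite (_ : a + _ = u *: (a + y) + (1 - u) *: (a + z)); first exact: conv_convex.
    rewrite !scalerDr [X in _ = X]addrACA [(1 - u) *: a]scalerBl.
    by rewrite scale1r [u *: a + _]addrC subrK.
  apply: (@conv_min (fun a => conv st (a + b)) s) sa => {a} [y z u u0 u1 h1 h2|a as_].
    rewrite (_ : _ + b = u *: (y + b) + (1 - u) *: (z + b)); first exact: conv_convex.
    rewrite !scalerDr [X in _ = X]addrACA [(1 - u) *: b]scalerBl.
    by rewrite scale1r [u *: b + _]addrC subrK.
  by apply: conv_mem; apply: allpairs_f.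
apply: conv_min => [y z u u0 u1|y].
  case=> a [b [sa [tb ->]]] [a' [b' [sa' [tb' ->]]]].
  exists (u *: a + (1 - u) *: a'), (u *: b + (1 - u) *: b').
  split; first exact: conv_convex.
  split; first exact: conv_convex.
  by rewrite !scalerDr addrACA.
case/allpairsP=> -[a b] /= [sa tb ->]; exists a, b.
by split; [exact: conv_mem | split=> //; exact: conv_mem].
Qed.

Lemma polytope_pzero : is_polytope (@pzero R V).
Proof.
exists [:: 0]; split=> // x; split=> [->|]; first by apply: conv_mem; rewrite inE.
apply: (@conv_min (@pzero R V)) => [y z t _ _ -> ->|y]; last by rewrite inE => /eqP.
by rewrite /pzero !scaler0 addr0.
Qed.

Lemma polytope_pneg A : is_polytope A -> is_polytope (pneg A).
Proof.
move=> [s [s0 As]]; exists [seq - x | x <- s]; split; first by case: s s0 {As}.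
move=> x; rewrite /pneg As; split.
  move=> sx; rewrite -[x]opprK.
  apply: (@conv_min (fun x => conv _ (- x)) s) sx => [y z u u0 u1 h1 h2|y ys].
    by rewrite opprD -!scalerN; apply: conv_convex.
  by apply: conv_mem; apply: map_f.
apply: (@conv_min (fun x => conv s (- x))) => [y z u u0 u1 h1 h2|y /mapP[z zs ->]].
  by rewrite opprD -!scalerN; apply: conv_convex.
by rewrite opprK; apply: conv_mem.
Qed.

Definition supp A (f : V -> R) (m : R) :=
  (exists2 x, A x & f x = m) /\ forall x, A x -> f x <= m.

Lemma supp_msum A B f a b : islin f -> supp A f a -> supp B f b ->
  supp (msum A B) f (a + b).
Proof.
move=> fl [[x Ax <-] Ale] [[y By <-] Ble]; split.
  by exists (x + y); [exists x, y | rewrite linD].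
by move=> z [x' [y' [Ax' [By' ->]]]]; rewrite linD // lerD ?Ale ?Ble.
Qed.

Lemma supp_seteq A B f m : seteq A B -> supp A f m -> supp B f m.
Proof.
move=> AB [[x Ax fx] Ale]; split; first by exists x; rewrite -?AB.
by move=> y; rewrite -AB; apply: Ale.
Qed.

(** A point of one polytope outside the other would be strictly separated from it by a form, on
    which the maxima would differ. *)
Lemma polytope_eq A B : is_polytope A -> is_polytope B ->
  (forall f, islin f -> exists2 m, supp A f m & supp B f m) -> seteq A B.
Proof.
have sub A' B' x : is_polytope B' ->
    (forall f, islin f -> exists2 m, supp A' f m & supp B' f m) -> A' x -> B' x.
  move=> [s [s0 Bs]] H Ax; apply: NNPP; rewrite Bs => /conv_sep[f [fl fx]].
  have [m [_ Am] [[y By fy] _]] := H f fl.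
  have := fx y; rewrite -Bs => /(_ By); rewrite fy; have := Am x Ax; lra.
move=> pA pB H x; split; apply: sub => // f /H[m]; by exists m.
Qed.

End Convexity.

(** * Faces as index sets *)

Section SpanLemmas.
Variables (R : realFieldType) (V : vectType R).

Lemma lin_span (f : V -> R) (X : seq V) : islin f -> (forall x, x \in X -> f x = 0) ->
  forall u, u \in <<X>>%VS -> f u = 0.
Proof.
move=> fl fX u uX; rewrite (coord_span (X := in_tuple X) uX) lin_sum //.
by rewrite big1 // => i _; rewrite fX ?mulr0 // mem_nth.
Qed.

Lemma exists_free_subset (X : seq V) :
  exists Y : seq V, [/\ free Y, {subset Y <= X} & <<Y>>%VS = <<X>>%VS].
Proof.
elim: X => [|x X [Y [fY sY EY]]].
  by exists [::]; split=> //; rewrite nil_free.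
have [xY|xY] := boolP (x \in <<Y>>%VS).
  exists Y; split=> // [y /sY yX|]; first by rewrite inE yX orbT.
  by rewrite span_cons -EY; apply/esym/addv_idPr; rewrite -memvE.
exists (x :: Y); split; first by rewrite free_cons xY.
  by move=> y; rewrite !inE => /orP[->//|/sY->]; rewrite orbT.
by rewrite !span_cons EY.
Qed.

Lemma dim_line_add (U : {vspace V}) v : v \notin U -> \dim (<[v]> + U) = (\dim U).+1.
Proof.
move=> vU; rewrite dimv_disjoint_sum ?dim_vline.
  by rewrite (_ : v != 0) //; apply: contraNneq vU => ->; apply: mem0v.
apply/eqP; rewrite -subv0; apply/subvP=> w; rewrite memv_cap memv0.
case/andP=> /vlineP[c ->]; have [->|c0 cv] := eqVneq c 0; first by rewrite scale0r.
by case/negP: vU; rewrite -[v](scalerK c0) memvZ.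
Qed.
End SpanLemmas.

Section Faces.
Variables (R : realFieldType) (V : vectType R) (s : seq V).
Local Notation T := 'I_(size s).
Implicit Types I J K : {set T}.
Let pt (i : T) : V := s`_i.

(** The instance of [Phi]: affine functions read off at the generators. *)
Definition affine_values (f : T -> R) :=
  exists g c, islin g /\ forall i, f i = g (pt i) + c.

Definition dirs I : {vspace V} := <<[seq pt p.1 - pt p.2 | p in setX I I]>>%VS.
(* Dimension of the cone over the face [I], i.e. [dim + 1], and [0] for [set0]. *)
Definition cone_rank I : nat := (I != set0) + \dim (dirs I).
Definition hull I : pset V := conv [seq pt i | i in I].

Lemma mem_dirs I i j : i \in I -> j \in I -> pt i - pt j \in dirs I.
Proof.
move=> iI jI; apply: memv_span; apply/imageP; exists (i, j) => //.
by rewrite inE iI jI.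
Qed.

Lemma dirs_sub I (U : {vspace V}) j :
  (forall i, i \in I -> pt i - pt j \in U) -> (dirs I <= U)%VS.
Proof.
move=> H; apply/span_subvP=> x /imageP[[i i']]; rewrite inE /= => /andP[iI i'I] ->.
by rewrite -(subrKA (pt j)) -[pt j - _]opprB; apply: rpredB; rewrite H.
Qed.

Lemma dirs0 : dirs set0 = 0%VS.
Proof.
apply/eqP; rewrite -subv0; apply/span_subvP=> x /imageP[[i i']].
by rewrite !inE.
Qed.

Lemma cone_rank0 : cone_rank set0 = 0%N.
Proof. by rewrite /cone_rank eqxx dirs0 dimv0. Qed.

Lemma affine_valuesD f g c : affine_values f -> affine_values g ->
  affine_values (fun i => f i + c * g i).
Proof.
move=> [f' [a [fl Ef]]] [g' [b [gl Eg]]].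
exists (fun x => f' x + c * g' x), (a + c * b); split; first exact: islin_comb.
by move=> i; rewrite Ef Eg; ring.
Qed.

Lemma affine_values_cst c : affine_values (fun=> c).
Proof.
exists (fun=> 0), c; split=> [a x y|i]; last by rewrite add0r.
by rewrite mulr0 addr0.
Qed.

Lemma affine_values_lin g c : islin g -> affine_values (fun i => c - g (pt i)).
Proof.
move=> gl; exists (fun x => - g x), c; split=> [|i]; first exact: islinN.
by rewrite addrC.
Qed.

Lemma sub_dirs_sep K (U : {vspace V}) j :
  (forall g, islin g -> (forall u, u \in U -> g u = 0) ->
     forall i, i \in K -> g (pt i) = g (pt j)) ->
  (dirs K <= U)%VS.
Proof.
move=> H; apply: (@dirs_sub _ _ j) => i iK; apply/negPn/negP.
case/exists_lin_ne0=> g [gl gU]; rewrite linB // subr_eq0 => /eqP; apply.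
exact: H.
Qed.

(** This is the hypothesis [rank_cover]. Given a point [j] of [J], the form [h] shows that
    [pt k - pt j] is not in [dirs J], and by duality the two together span [dirs K]. For empty [J],
    the points of [K] coincide and the rank goes from [0] to [1]. *)
Lemma cone_rank_cover (J K : {set T}) h k :
  J \subset K -> k \in K -> affine_values h ->
  (forall i, i \in J -> h i = 0) -> 0 < h k ->
  (forall f, affine_values f -> (forall i, i \in J -> f i = 0) -> f k = 0 ->
     forall i, i \in K -> f i = 0) ->
  cone_rank K = (cone_rank J).+1.
Proof.
move=> sJK kK [g [c [gl Eh]]] h0 hk H; rewrite /cone_rank.
have -> : K != set0 by apply/set0Pn; exists k.
have H' g' j : islin g' -> (forall i, i \in J -> g' (pt i) = g' (pt j)) ->
    g' (pt k) = g' (pt j) -> forall i, i \in K -> g' (pt i) = g' (pt j).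
  move=> gl' gJ gk i iK; apply/eqP; rewrite eq_sym -subr_eq0; apply/eqP.
  apply: (H (fun i => g' (pt j) - g' (pt i))) => //.
  - exact: affine_values_lin.
  - by move=> i' /gJ->; rewrite subrr.
  - by rewrite gk subrr.
have [J0|[j jJ]] := set_0Vmem J.
  rewrite J0 eqxx dirs0 dimv0; suff /eqP-> : dirs K == 0%VS by rewrite dimv0.
  rewrite -subv0; apply: (@sub_dirs_sep _ _ k) => g' gl' _.
  by apply: H' => // i; rewrite J0 inE.
have -> : J != set0 by apply/set0Pn; exists j.
have jK := subsetP sJK _ jJ.
rewrite -addnS -(@dim_line_add _ _ _ (pt k - pt j)); last first.
  apply/negP=> kj; have : g (pt k - pt j) = 0.
    apply: lin_span kj => // x /imageP[[i i']]; rewrite inE /= => /andP[iJ i'J] ->.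
    have := h0 _ iJ; have := h0 _ i'J; rewrite !Eh linB //; lra.
  have := h0 _ jJ; move: hk; rewrite !Eh linB //; lra.
congr (_ + \dim _)%N; apply/eqP; rewrite eqEsubv; apply/andP; split.
  apply: (@sub_dirs_sep _ _ j) => g' gl' gU.
  have gk : g' (pt k) = g' (pt j).
    apply/eqP; rewrite -subr_eq0 -linB //; apply/eqP/gU.
    by apply: (subvP (addvSl _ _)); exact: memv_line.
  apply: H' => // i iJ; apply/eqP; rewrite -subr_eq0 -linB //; apply/eqP/gU.
  by apply: (subvP (addvSr _ _)); exact: mem_dirs.
rewrite subv_add -memvE mem_dirs //=.
by apply: (@dirs_sub _ _ j) => i iJ; apply: mem_dirs; rewrite // (subsetP sJK).
Qed.

Lemma hull_mem I i : i \in I -> hull I (pt i).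
Proof. by move=> iI; apply: conv_mem; apply/imageP; exists i. Qed.

Lemma hull_min (A : pset V) I : convex A -> (forall i, i \in I -> A (pt i)) ->
  forall x, hull I x -> A x.
Proof. by move=> cA AI; apply: conv_min => // x /imageP[i iI ->]; apply: AI. Qed.

(** A free list of differences within the hull lies in [dirs I], which bounds its length; conversely
    a basis of [dirs I] can be extracted from the differences of generators. *)
Lemma affdim_hull (F : pset V) I : I != set0 -> seteq F (hull I) ->
  affdim F = \dim (dirs I).
Proof.
case/set0Pn=> i0 i0I FI; apply/eqP; rewrite eqn_leq; apply/andP; split.
  apply/bigmax_leqP => k /pbP[t [tk [ft Ht]]]; rewrite -tk.
  move: ft; rewrite /free => /eqP <-; apply: dimvS; apply/span_subvP=> u ut.
  have ui : (index u t < k)%N by rewrite -tk index_mem.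
  have [x [y [Fx [Fy]]]] := Ht _ ui; rewrite nth_index // => ->.
  have D z : F z -> z - pt i0 \in dirs I.
    rewrite FI; apply: (@hull_min (fun z => z - pt i0 \in dirs I)).
      move=> a b w _ _ Da Db.
      rewrite (_ : _ - _ = w *: (a - pt i0) + (1 - w) *: (b - pt i0)).
        by rewrite rpredD // memvZ.
      rewrite !scalerBr addrACA -opprD; congr (_ - _).
      by rewrite scalerBl scale1r addrC subrK.
    by move=> i iI; apply: mem_dirs.
  by rewrite -(subrKA (pt i0)) -[pt i0 - _]opprB; apply: rpredB; apply: D.
have [Y [fY sY EY]] := exists_free_subset [seq pt p.1 - pt p.2 | p in setX I I].
have dY : \dim (dirs I) = size Y by rewrite /dirs -EY; apply/eqP.
have Yn : (size Y < (\dim {: V}).+1)%N by rewrite -dY ltnS dimvS // subvf.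
rewrite dY -[size Y]/(val (Ordinal Yn)); apply: leq_bigmax_cond.
apply/pbP; exists Y; split=> //; split=> // i iY.
have /sY/imageP[[a b]] := mem_nth 0 iY; rewrite inE => /andP[/= aI bI] ->.
by exists (pt a), (pt b); rewrite !FI; do !split=> //; apply: hull_mem.
Qed.

Definition argmaxs (f : V -> R) : {set T} :=
  [set i | [forall j, f (pt j) <= f (pt i)]].

Lemma conv_le (f : V -> R) m : islin f -> (forall j, f (pt j) <= m) ->
  forall x, conv s x -> f x <= m.
Proof.
move=> fl fm x; apply: (@conv_min _ _ (fun x => f x <= m)).
  by move=> y z t t0 t1 fy fz; rewrite fl linZ //; nra.
by move=> y /(nthP 0)[i si <-]; apply: (fm (Ordinal si)).
Qed.

Lemma face_argmaxs (f : V -> R) i : islin f ->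
  face_of (conv s) f (pt i) <-> i \in argmaxs f.
Proof.
move=> fl; rewrite inE; split=> [[_ H]|/forallP H].
  by apply/forallP=> j; apply: H; apply: conv_nth.
by split; [exact: conv_nth | exact: conv_le].
Qed.

(** If a convex combination [x] with weights [w] is maximal, the nonnegative terms
    [w k * (f x - f (pt k))] sum to zero, so every generator of nonzero weight is itself maximal. *)
Lemma face_of_hull (f : V -> R) : islin f ->
  seteq (face_of (conv s) f) (hull (argmaxs f)).
Proof.
move=> fl x; split; last first.
  apply: hull_min => [y z t t0 t1 [Cy fy] [Cz fz]|i /face_argmaxs]; last exact.
  split; first exact: conv_convex.
  move=> q /[dup] /fy qy /fz qz; rewrite fl linZ //; nra.
case=> -[w [w0 [w1 Ex]]] fx; rewrite Ex; apply: convex_sum => //.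
  exact: conv_convex.
move=> i wi; apply: hull_mem; rewrite inE; apply/forallP=> j.
have sum0 : \sum_k w k * (f x - f (pt k)) = 0.
  under eq_bigr do rewrite mulrBr.
  by rewrite sumrB -mulr_suml w1 mul1r Ex lin_sum // subrr.
have ge0 k : 0 <= w k * (f x - f (pt k)).
  by rewrite mulr_ge0 // subr_ge0; apply: fx; apply: conv_nth.
move/eqP: sum0; rewrite psumr_eq0 // => /allP/(_ i).
rewrite mem_index_enum => /(_ isT); rewrite mulf_eq0 (negPf wi) subr_eq0 /=.
by move/eqP<-; apply: fx; apply: conv_nth.
Qed.

Hypothesis s_neq0 : s <> [::].

Lemma exists_argmax (a : T -> R) I : I != set0 ->
  exists2 i, i \in I & forall j, j \in I -> a j <= a i.
Proof.
case/set0Pn=> i0 i0I.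
by case: (@arg_maxP _ _ _ i0 (mem I) a i0I) => i iI H; exists i.
Qed.

Lemma setT_neq0 : [set: T] != set0.
Proof.
have s0 : (0 < size s)%N by case: s s_neq0.
by apply/set0Pn; exists (Ordinal s0); rewrite inE.
Qed.

Lemma argmaxs_neq0 f : argmaxs f != set0.
Proof.
have [i _ H] := exists_argmax (fun i => f (pt i)) setT_neq0.
by apply/set0Pn; exists i; rewrite inE; apply/forallP=> j; apply: H; rewrite inE.
Qed.

Lemma argmaxs_exposed f : islin f -> exposed affine_values (argmaxs f).
Proof.
move=> fl; have /set0Pn[i] := argmaxs_neq0 f; rewrite inE => /forallP fi.
apply/exposedP; exists (fun j => f (pt i) - f (pt j)); split.
  exact: affine_values_lin.
split=> j; rewrite inE.
  by move/forallP/(_ i) => H; apply/eqP; rewrite subr_eq0 eq_le H fi.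
case/forallPn=> k; rewrite -ltNge subr_gt0 => H.
exact: lt_le_trans H (fi k).
Qed.

Lemma exposed_argmaxs I : exposed affine_values I -> I != set0 ->
  exists2 f, islin f & argmaxs f = I.
Proof.
case/exposedP=> h [[g [c [gl Eh]]] [h0 hp]] /set0Pn[i0 i0I].
exists (fun x => - g x); first exact: islinN.
have hge i : 0 <= h i by have [/h0->//|/hp/ltW] := boolP (i \in I).
apply/setP=> i; rewrite inE; apply/forallP/idP => [H|iI j].
  apply/negPn/negP=> /hp; have := H i0; have := h0 _ i0I; rewrite !Eh; lra.
have := h0 _ iI; have := hge j; rewrite !Eh; lra.
Qed.

(* Junk value [0] on [set0]. *)
Definition maxval (a : T -> R) I : R :=
  if [pick i | (i \in I) && [forall (j | j \in I), a j <= a i]] is Some i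
  then a i else 0.

Lemma maxvalP a I : I != set0 -> exists2 i, i \in I & a i = maxval a I.
Proof.
move=> I0; rewrite /maxval; case: pickP => [i /andP[iI _]|no]; first by exists i.
have [i iI H] := exists_argmax a I0; have := no i; rewrite iI /=.
by move/negP; case; apply/forall_inP.
Qed.

Lemma maxval_ge a I i : i \in I -> a i <= maxval a I.
Proof.
move=> iI; rewrite /maxval; case: pickP => [j /andP[_ /forall_inP]|no]; first exact.
have I0 : I != set0 by apply/set0Pn; exists i.
have [j jI H] := exists_argmax a I0; have := no j; rewrite jI /=.
by move/negP; case; apply/forall_inP.
Qed.

Lemma supp_hull f I : islin f -> I != set0 ->
  supp (hull I) f (maxval (fun i => f (pt i)) I).
Proof.
move=> fl I0; split.
  have [i iI E] := maxvalP (fun i => f (pt i)) I0.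
  by exists (pt i); [exact: hull_mem | ].
apply: (@hull_min (fun x => f x <= _)) => [y z t t0 t1 fy fz|i iI].
  by rewrite fl linZ //; nra.
exact: (maxval_ge (fun i => f (pt i))).
Qed.

(** The instance of [sum_sgn_max] for affine forms; [cone_rank] is [dim + 1] on nonempty sets, hence
    the change of sign. *)
Lemma sum_faces f m i0 : islin f -> f (pt i0) = m -> (forall i, m <= f (pt i)) ->
  \sum_(I | exposed affine_values I && (I != set0))
    (-1) ^+ \dim (dirs I) * maxval (fun i => f (pt i)) I = m.
Proof.
move=> fl f0 fm.
have := @sum_sgn_max R T affine_values cone_rank affine_valuesD cone_rank_cover
  (affine_values_cst 1) (affine_values_cst 0) cone_rank0 (fun i => f (pt i))
  (maxval (fun i => f (pt i))) m i0.
move=> /(_ _ _ _ f0 fm) H; apply/oppr_inj; rewrite -H.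
- rewrite -sumrN; apply: eq_bigr => I /andP[_ I0].
  by rewrite /sgn /cone_rank I0 add1n exprS mulN1r mulNr.
- by move=> c; apply: affine_values_lin.
- by move=> I i; apply: maxval_ge.
- exact: maxvalP.
Qed.

End Faces.

(** * Minkowski sums over a list of faces, and the theorem *)

Section Enumeration.
Variables (R : realFieldType) (V : vectType R).

(** Additivity of support functions. Entries rejected by [p] count as zero, so that the even and odd
    sums run over the same indices. *)
Lemma supp_msum_seq (p : pred (pset V)) f (fs : seq (pset V)) (v : nat -> R) :
  islin f ->
  (forall i, (i < size fs)%N -> supp (nth (@pzero R V) fs i) f (v i)) ->
  supp (msum_seq [seq F <- fs | p F]) f
    (\sum_(i < size fs) if p (nth (@pzero R V) fs i) then v i else 0).
Proof.
move=> fl; elim: fs v => [|F fs IH] v H.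
  rewrite big_ord0; split; first by exists 0 => //; exact: lin0.
  by move=> x ->; rewrite lin0.
have {}IH := IH (fun i => v i.+1) (fun i => H i.+1).
rewrite big_ord_recl /=; case: ifP => _; last by rewrite add0r.
by apply: supp_msum => //; apply: (H 0%N).
Qed.

Lemma seteq_sym (A B : pset V) : seteq A B -> seteq B A.
Proof. by move=> H x; rewrite H. Qed.

Lemma seteq_trans (A B C : pset V) : seteq A B -> seteq B C -> seteq A C.
Proof. by move=> H H' x; rewrite H. Qed.

Lemma face_of_seteq (A B : pset V) f g : seteq A B -> f =1 g ->
  seteq (face_of A f) (face_of B g).
Proof.
move=> AB fg x; split=> -[Ax H]; split; try exact/AB; move=> q /AB Aq.
  by rewrite -!fg; apply: H.
by rewrite !fg; apply: H.
Qed.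
End Enumeration.

(* *P = - sum_{F in F(P)} (-1)^{dim F} F  in P(V), i.e.
   [*P] + sum_{dim F even} [F] = sum_{dim F odd} [F]. *)
Theorem theorem5p2 (R : realFieldType) (V : vectType R) (P : pset V)
  (hP : is_polytope P) (fs : seq (pset V)) (hfs : face_enum P fs) :
  groth_eq (msum (pneg P) (msum_seq [seq F <- fs | ~~ odd (affdim F)]))
           (msum_seq [seq F <- fs | odd (affdim F)]).
Proof.
have [s [s0 Ps]] := hP; have [faceP faceI] := hfs.
pose F i := nth (@pzero R V) fs i.
(* The generators on the [k]-th face; [ind] will be a bijection onto the nonempty exposed sets. *)
pose ind (k : 'I_(size fs)) : {set 'I_(size s)} :=  [set i : 'I_(size s) | pb (F k s`_i)].
have indE (k : 'I_(size fs)) f : islin f -> seteq (F k) (face_of (conv s) f) ->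
    ind k = argmaxs s f.
  move=> fl Fk; apply/setP=> i; apply/idP/idP; rewrite [_ \in ind k]inE.
    by move/pbP/Fk/face_argmaxs; apply.
  by move=> /(face_argmaxs _ fl) ?; apply/pbP/Fk.
have indP (k : 'I_(size fs)) :
    exists f, [/\ islin f, ind k = argmaxs s f & seteq (F k) (hull (ind k))].
  have [phi Fphi] : is_face P (F k) by apply/faceP; exists k.
  have fl := islin_linear phi; exists phi.
  have Fk : seteq (F k) (face_of (conv s) phi).
    by apply: seteq_trans Fphi _; apply: face_of_seteq.
  have E := indE k _ fl Fk; rewrite E; split=> //.
  by apply: (seteq_trans Fk); apply: face_of_hull.
have ind0 (k : 'I_(size fs)) : ind k != set0.
  by have [f [_ -> _]] := indP k; exact: argmaxs_neq0.
have indH (k : 'I_(size fs)) : seteq (F k) (hull (ind k)) by have [f []] := indP k.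
have ind_inj : injective ind.
  move=> k l kl; apply: faceI; apply: seteq_trans (indH k) _.
  by rewrite kl; apply: seteq_sym.
have ind_img : ind @: setT =
    [set I | exposed (@affine_values R V s) I && (I != set0)].
  apply/setP=> I; rewrite inE; apply/imsetP/andP => [[k _ ->]|[eI I0]].
    by split=> //; have [f [fl -> _]] := indP k; exact: argmaxs_exposed.
  have [f fl <-] := exposed_argmaxs eI I0.
  have [phi Ephi] := islin_exists fl.
  have /faceP[k Hk] : is_face P (face_of (conv s) f).
    by exists phi; apply: face_of_seteq; [exact: seteq_sym | move=> x; rewrite Ephi].
  by exists k => //; rewrite (indE k f fl) //; exact: seteq_sym.
have polyF k : (k < size fs)%N -> is_polytope (F k).
  move=> kfs; apply: (polytope_seteq (indH (Ordinal kfs))).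
  exists [seq s`_(i : 'I_(size s)) | i in ind (Ordinal kfs)]; split=> //.
  have /set0Pn[i iI] := ind0 (Ordinal kfs).
  move=> E0; have : s`_i \in [seq s`_(i : 'I_(size s)) | i in ind (Ordinal kfs)].
    by apply/imageP; exists i.
  by rewrite E0.
have polyS p : is_polytope (msum_seq [seq G <- fs | p G]).
  move: polyF; rewrite /F; elim: (fs) => [_|G gs IH H]; first exact: polytope_pzero.
  have {}IH := IH (fun k => H k.+1).
  rewrite /=; case: ifP => _ //.
  by apply: polytope_msum => //; apply: (H 0%N).
(* Both sides are equal as sets, so the polytope [{0}] serves as [K]. *)
exists (@pzero R V); split; first exact: polytope_pzero.
apply: msum_seteq => //; apply: polytope_eq => // [|f fl].
  by apply: polytope_msum => //; apply: polytope_pneg.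
have [i0 _ min0] := exists_argmax (fun i : 'I_(size s) => - f s`_i) (setT_neq0 s0).
set m := f s`_i0.
have fm (i : 'I_(size s)) : m <= f s`_i.
  by have := min0 i; rewrite lerN2; apply; rewrite inE.
(* [supp_msum_seq] takes values indexed by [nat]; the default [0] only concerns indices beyond
   [fs]. *)
pose v k := if insub k is Some k'
  then maxval (fun i : 'I_(size s) => f s`_i) (ind k') else 0.
have vE (k : 'I_(size fs)) : v k = maxval (fun i : 'I_(size s) => f s`_i) (ind k).
  by rewrite /v valK.
have suppF k : (k < size fs)%N -> supp (F k) f (v k).
  move=> kfs; rewrite (vE (Ordinal kfs)).
  apply: supp_seteq (seteq_sym (indH (Ordinal kfs))) _.
  exact: supp_hull.
have suppN : supp (pneg P) f (- m).
  split; first by exists (- s`_i0); rewrite ?linN // /pneg opprK Ps; exact: conv_nth.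
  move=> x; rewrite /pneg Ps => /(conv_le (islinN fl)) H.
  by rewrite -[f x]opprK -linN // lerN2 -lerN2; apply: H => j; rewrite lerN2.
have even_supp := supp_msum_seq (fun G => ~~ odd (affdim G)) fl suppF.
have odd_supp := supp_msum_seq (fun G => odd (affdim G)) fl suppF.
eexists; first exact: supp_msum suppN even_supp.
have := sum_faces fl (erefl m) fm.
rewrite (eq_bigl (mem (ind @: setT))) => [|I]; last by rewrite ind_img /= inE.
rewrite big_imset /=; last by move=> k l _ _; apply: ind_inj.
rewrite (eq_bigl predT) => [|k]; last by rewrite inE.
(* It remains to see that [- m] plus the even sum is the odd sum: replace [m] by the signed sum over
   all faces and compare term by term. *)
move=> Em; rewrite [X in supp _ f X](_ : _ = \sum_(i < size fs)
  if odd (affdim (F i)) then v i else 0) //.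
rewrite -Em -sumrN -big_split; apply: eq_bigr => k _ /=.
rewrite -/(F k) vE (affdim_hull (ind0 k) (indH k)) -signr_odd.
by case: odd; rewrite ?expr1 ?expr0 /=; ring.
Qed.
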